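(* Let $k\ge 2$ and $n\ge 1$ be integers. For every $\lambda\in[0,1]$ and every $p=(p_1,\dots,p_k)\in\Delta^{k-1}$, $$\varphi_{k,n}(\lambda,p)\le G_{k,n}(\lambda,p).$$
   Context: $\Delta^{k-1}=\{p\in\mathbb{R}^k: p_i\ge 0,\ \sum_{i=1}^k p_i=1\}$. Let $(X_1,\dots,X_k)$ have the multinomial distribution with $n$ trials and probability vector $p$, and let $\hat p=(X_1/n,\dots,X_k/n)$. The relative entropy is $\mathcal{D}(\hat p\|p)=\sum_{i=1}^k \hat p_i\log(\hat p_i/p_i)$ with natural logarithm and conventions $0\cdot\log(0)=0$, $0\cdot\log(0/0)=0$ (it is finite almost surely, since $X_i=0$ almost surely when $p_i=0$). The moment generating function is $\varphi_{k,n}(\lambda,p):=\mathbb{E}\exp(\lambda n\mathcal{D}(\hat p\|p))$. Also $$G_{k,n}(\lambda,p):=\sum_{X_1,\dots,X_k}\binom{n}{X_1,\dots,X_k}\prod_{i=1}^k\left[\lambda X_i/n+(1-\lambda)p_i\right]^{X_i},$$ where the sum is over non-negative integers $X_1,\dots,X_k$ with $X_1+\dots+X_k=n$, and $0^0=1$. *)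

(* Defs.v *)
From HB Require Import structures.
From mathcomp Require Import all_boot all_order all_algebra.
From mathcomp Require Import all_classical all_reals all_analysis.

Set Implicit Arguments.
Unset Strict Implicit.
Unset Printing Implicit Defensive.

Import Order.TTheory GRing.Theory Num.Theory.

Local Open Scope classical_set_scope.
Local Open Scope ring_scope.

Definition simplex (R : realType) (k : nat) (p : 'I_k -> R) : Prop :=
  (forall i, 0 <= p i) /\ \sum_(i < k) p i = 1.

(* Only meaningful when the x i sum to n; every use below guards this. *)
Definition multinomial_coef (R : realType) (k n : nat) (x : 'I_k -> nat) : R :=
  n`!%:R / (\prod_(i < k) (x i)`!)%N%:R.

Definition multinomial_pmf (R : realType) (k n : nat) (p : 'I_k -> R)
    (x : 'I_k -> nat) : R :=
  if (\sum_(i < k) x i == n)%N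
  then multinomial_coef R n x * \prod_(i < k) p i ^+ x i
  else 0.

Definition has_multinomial_distribution d (T : measurableType d)
    (R : realType) (P : probability T R) (k n : nat) (p : 'I_k -> R)
    (X : 'I_k -> {RV P >-> nat}) : Prop :=
  forall x : 'I_k -> nat,
    P [set w | forall i, X i w = x i] = (multinomial_pmf n p x)%:E.

Definition empirical (R : realType) (k n : nat) (x : 'I_k -> nat) : 'I_k -> R :=
  fun i => (x i)%:R / n%:R.

(* a log(a/b), with 0 log 0 = 0 log(0/0) = 0 and a log(a/0) = +oo for a > 0. *)
Definition entropy_term (R : realType) (a b : R) : \bar R :=
  if a == 0 then 0%E
  else if b == 0 then +oo%E
  else (a * ln (a / b))%:E.

Definition relative_entropy (R : realType) (k : nat) (q p : 'I_k -> R) :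
  \bar R := (\sum_(i < k) entropy_term (q i) (p i))%E.

(* When X is multinomial with parameters n and p, the relative entropy below is
   finite almost surely, so that [fine] alters it on a null event only. *)
Definition phi d (T : measurableType d) (R : realType) (P : probability T R)
    (k n : nat) (X : 'I_k -> {RV P >-> nat}) (lambda : R) (p : 'I_k -> R) :
  \bar R :=
  'M_P (fun w => n%:R *
    fine (relative_entropy (empirical R n (fun i => X i w)) p)) lambda.

(* Nonnegative integers summing to n are all at most n, whence 'I_n.+1. *)
Definition G (R : realType) (k n : nat) (lambda : R) (p : 'I_k -> R) : R :=
  \sum_(x : {ffun 'I_k -> 'I_n.+1} | (\sum_(i < k) x i == n)%N)
    multinomial_coef R n (fun i => x i : nat) *
    \prod_(i < k) (lambda * (x i)%:R / n%:R + (1 - lambda) * p i) ^+ x i.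

(* Main.v *)
(* MathComp with MathComp-Analysis. *)
Require Import Defs.
From HB Require Import structures.
From mathcomp Require Import all_boot all_order all_algebra.
From mathcomp Require Import all_classical all_reals all_analysis.
From mathcomp Require Import measurable_realfun.

Import Order.TTheory GRing.Theory Num.Theory.

Local Open Scope classical_set_scope.
Local Open Scope ring_scope.

(** Both sides are sums over the vectors [x] of counts with total [n], and the
    inequality holds term by term.  On the event that the counts are [x],
    [exp (lambda n D)] is the product of the [(q_i / p_i) ^ (lambda x_i)] with
    [q_i = x_i / n], so that [x] contributes to the moment generating function
    its multinomial coefficient times the product of the
    [(p_i ^ (1 - lambda) q_i ^ lambda) ^ x_i].  By the weighted inequality of
    arithmetic and geometric means (Young's inequality) each base is at most
    [lambda q_i + (1 - lambda) p_i]; this is [young_power], and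
    [multinomial_pmf_tilt_le] assembles the factors.  A vector with [x_i > 0]
    for some [p_i = 0] has probability zero, while its term in [G] is
    nonnegative.

    The measure-theoretic part is [expectation_countable], which turns the
    expectation of a nonnegative function of a countably valued variable into a
    finite sum as soon as all but finitely many values have probability zero.
    By countability the exceptional values together form a null event; here they
    are the vectors with an entry above [n], whose total differs from [n]. *)

(** * Expectation of a function of a countably valued variable *)

Section countable_valued.
Context d (T : measurableType d) (R : realType) (P : probability T R).
Context (I : countType) (Y : T -> I).
Hypothesis mY : forall y, measurable (Y @^-1` [set y]).

Lemma measurable_preimage_countable (A : set I) : measurable (Y @^-1` A).
Proof.
have -> : Y @^-1` A = \bigcup_y (if `[< A y >] then Y @^-1` [set y] else set0).
  apply/seteqP; split => [w Aw|w [y _]].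
    by exists (Y w) => //=; rewrite asboolT.
  by case: asboolP => // Ay /= ->.
apply: countable_bigcupT_measurable => [|y]; first exact: countableP.
by case: ifP.
Qed.

(** Almost everywhere [f \o Y] is the combination, with coefficients [f y] for
    [y] in [s], of the indicators of the events [Y = y], since the other events
    [Y = y] form a countable family of null events. *)
Lemma expectation_countable (s : seq I) (f : I -> R) :
  uniq s -> (forall y, y \notin s -> P (Y @^-1` [set y]) = 0%E) ->
  (forall y, 0 <= f y) ->
  ('E_P[f \o Y] = \sum_(y <- s) (f y)%:E * P (Y @^-1` [set y]))%E.
Proof.
move=> us Ps0 f0.
have Yneg : P.-negligible (Y @^-1` [set y | y \notin s]).
  have -> : Y @^-1` [set y | y \notin s] =
      \bigcup_m (if unpickle m is Some y then
                 if y \notin s then Y @^-1` [set y] else set0 else set0).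
    apply/seteqP; split => [w /= Yw|w [m _]].
      by exists (pickle (Y w)) => //; rewrite pickleK Yw.
    by case: unpickle => // y; case: ifP => // ys /= ->.
  apply: negligible_bigcup => m; case: unpickle => [y|]; last first.
    exact: negligible_set0.
  by case: ifPn => [/Ps0 /negligibleP|_]; [apply|exact: negligible_set0].
rewrite unlock.
transitivity
  (\int[P]_w (\sum_(y <- s) (f y)%:E * (\1_(Y @^-1` [set y]) w)%:E))%E.
  apply: ge0_ae_eq_integral => //.
  - apply/measurable_EFinP => _ B _; rewrite setTI comp_preimage.
    exact: measurable_preimage_countable.
  - apply: emeasurable_sum => y.
    apply: measurable_funeM; apply/measurable_EFinP.
    exact: measurable_indic.
  - by move=> w _; rewrite lee_fin; exact: f0.
  - by move=> w _; apply: sume_ge0 => y _; rewrite -EFinM lee_fin mulr_ge0.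
  - apply: negligibleS Yneg => w /= /not_implyP[_]; apply: contra_notN => Ys.
    rewrite (bigD1_seq (Y w)) //= indicE mem_set // mule1 big1 ?adde0 // => y yY.
    by rewrite indicE memNset ?mule0 //= => Ywy; rewrite -Ywy eqxx in yY.
rewrite ge0_integral_sum //=; last 2 first.
- move=> y; apply: measurable_funeM; apply/measurable_EFinP.
  exact: measurable_indic.
- by move=> y w _; rewrite -EFinM lee_fin mulr_ge0.
apply: eq_bigr => y _; rewrite ge0_integralZl_EFin //=.
  by rewrite (integral_indic _ measurableT (mY y)) setIT.
by apply/measurable_EFinP; exact: measurable_indic.
Qed.

End countable_valued.

(** * Weighted arithmetic and geometric means *)

(** Convexity of the exponential between [u] and [0]. *)
Lemma expR_interpolate (R : realType) (l u : R) : 0 <= l <= 1 ->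
  expR (l * u) <= l * expR u + (1 - l).
Proof.
case/andP=> l0 l1.
have := @convex_expR R (Itv01 l0 l1) u 0.
by rewrite !convRE /= expR0 mulr0 addr0 mulr1.
Qed.

(** The left-hand side is [(a ^ (1 - l) * q ^ l) ^ m], written with the
    logarithm because that is the form in which the relative entropy yields
    it. *)
Lemma young_power (R : realType) (l a q : R) (m : nat) :
  0 <= l <= 1 -> 0 < a -> 0 < q ->
  a ^+ m * expR (l * (m%:R * ln (q / a))) <= (l * q + (1 - l) * a) ^+ m.
Proof.
move=> l01 a0 q0; rewrite mulrCA expRM_natl -exprMn lerXn2r ?nnegrE //.
- by rewrite mulr_ge0 ?expR_ge0 // ltW.
- by case/andP: l01 => l0 l1; rewrite addr_ge0 // mulr_ge0 ?subr_ge0 // ltW.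
have expl := expR_interpolate R l (ln (q / a)) l01.
apply: (le_trans (ler_wpM2l (ltW a0) expl)).
rewrite lnK ?posrE ?divr_gt0 //.
by rewrite mulrDr mulrCA (mulrC a (q / a)) divfK ?gt_eqF // (mulrC a).
Qed.

(** * The contribution of one vector of counts *)

Section terms.
Context (R : realType) (k n : nat).

(** When [p i = 0] forces [x i = 0] no summand is infinite, so [fine] keeps the
    value; summands with [x i = 0] vanish on both sides, whatever the value of the
    logarithm. *)
Lemma relative_entropy_empirical (p : 'I_k -> R) (x : 'I_k -> nat) :
  (0 < n)%N -> (forall i, 0 < p i \/ x i = 0%N) ->
  n%:R * fine (relative_entropy (empirical R n x) p) =
  \sum_(i < k) (x i)%:R * ln ((x i)%:R / n%:R / p i).
Proof.
move=> n0 xp.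
have nR : (n%:R : R) != 0 by rewrite pnatr_eq0 -lt0n.
have -> : relative_entropy (empirical R n x) p =
    (\sum_(i < k) ((x i)%:R / n%:R * ln ((x i)%:R / n%:R / p i)))%:E.
  rewrite /relative_entropy -sumEFin; apply: eq_bigr => i _.
  rewrite /entropy_term /empirical; case: eqP => [->|x0]; first by rewrite mul0r.
  by case: (xp i) => [/gt_eqF -> //|xi0]; rewrite xi0 mul0r in x0.
rewrite /= mulr_sumr; apply: eq_bigr => i _.
by rewrite mulrA mulrCA divff // mulr1.
Qed.

Lemma multinomial_coef_ge0 (x : 'I_k -> nat) : 0 <= multinomial_coef R n x.
Proof. by rewrite divr_ge0. Qed.

(** If [x i > 0] for some [p i = 0], then [fine] replaces an infinite entropy by
    zero, but the probability on the left is zero. *)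
Lemma multinomial_pmf_tilt_le (l : R) (p : 'I_k -> R) (x : 'I_k -> nat) :
  (0 < n)%N -> 0 <= l <= 1 -> (forall i, 0 <= p i) ->
  expR (l * (n%:R * fine (relative_entropy (empirical R n x) p))) *
    multinomial_pmf n p x <=
  if (\sum_(i < k) x i == n)%N then
    multinomial_coef R n x *
    \prod_(i < k) (l * (x i)%:R / n%:R + (1 - l) * p i) ^+ x i
  else 0.
Proof.
move=> n0 l01 p0; rewrite /multinomial_pmf; case: ifP => _; last by rewrite mulr0.
rewrite mulrCA ler_wpM2l ?multinomial_coef_ge0 //.
have base_ge0 i : 0 <= l * (x i)%:R / n%:R + (1 - l) * p i.
  by case/andP: l01 => l0 l1; rewrite addr_ge0 ?divr_ge0 ?mulr_ge0 ?subr_ge0.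
(* First the vectors of probability zero. *)
have [/existsP[i /andP[/eqP pi0 xi0]]|] :=
    boolP [exists i, (p i == 0) && (x i != 0%N)].
  rewrite (bigD1 i) //= pi0 expr0n (negbTE xi0) mul0r mulr0.
  by apply: prodr_ge0 => j _; exact: exprn_ge0.
rewrite negb_exists => /forallP xp.
have {}xp i : 0 < p i \/ x i = 0%N.
  have := xp i; rewrite negb_and negbK lt0r p0 andbT.
  by case/orP=> [->|/eqP ->]; [left|right].
rewrite relative_entropy_empirical // mulr_sumr expR_sum -big_split /=.
apply: ler_prod => i _; rewrite mulr_ge0 ?expR_ge0 ?exprn_ge0 //= mulrC.
have [->|xi0] := eqVneq (x i) 0%N; first by rewrite !expr0 !mul0r mulr0 expR0 mulr1.
case: (xp i) => [pi0|xi]; last by rewrite xi in xi0.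
rewrite -(mulrA l); apply: young_power => //.
by rewrite divr_gt0 // ltr0n // lt0n.
Qed.
End terms.

(** * The inequality *)

Theorem mainTheorem1 (R : realType) (k n : nat) (hk : (2 <= k)%N)
  (hn : (1 <= n)%N) (lambda : R) (hlambda : 0 <= lambda <= 1)
  (p : 'I_k -> R) (hp : simplex p)
  (d : measure_display) (T : measurableType d) (P : probability T R)
  (X : 'I_k -> {RV P >-> nat}) (hX : has_multinomial_distribution n p X) :
  (phi n X lambda p <= (G n lambda p)%:E)%E.
Proof.
(* The counts as one variable, with values in a countable type. *)
pose Y w : {ffun 'I_k -> nat} := [ffun i => X i w].
have YE (y : {ffun 'I_k -> nat}) :
    Y @^-1` [set y] = [set w | forall i, X i w = y i].
  apply/seteqP; split => w /=; first by move=> <- i; rewrite ffunE.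
  by move=> Xy; apply/ffunP => i; rewrite ffunE.
have mY y : measurable (Y @^-1` [set y]).
  rewrite YE.
  have -> : [set w | forall i, X i w = y i] =
      \bigcap_(i in [set: 'I_k]) (X i @^-1` [set y i]).
    by apply/seteqP; split => w /= Xy i; [move=> _|]; exact: Xy.
  apply: fin_bigcap_measurable => // i _.
  exact: measurable_funPTI.
(* The embedding of the index set of the sum G into the values of Y. *)
pose v (x : {ffun 'I_k -> 'I_n.+1}) : {ffun 'I_k -> nat} := [ffun i => x i : nat].
have v_inj : injective v.
  move=> x x' /ffunP xx'; apply/ffunP => i; apply/val_inj.
  by have := xx' i; rewrite !ffunE.
pose s := [seq v x | x <- index_enum {ffun 'I_k -> 'I_n.+1}].
have us : uniq s by rewrite map_inj_uniq // index_enum_uniq.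
have s0 y : y \notin s -> P (Y @^-1` [set y]) = 0%E.
  rewrite YE hX /multinomial_pmf => ys; case: eqP => // sy; case/negP: ys.
  have yn i : (y i < n.+1)%N by rewrite ltnS -sy (bigD1 i) //= leq_addr.
  apply/mapP; exists [ffun i => Ordinal (yn i)]; first by rewrite mem_index_enum.
  by apply/ffunP => i; rewrite !ffunE.
pose f (y : {ffun 'I_k -> nat}) : R :=
  expR (lambda * (n%:R * fine (relative_entropy (empirical R n y) p))).
have -> : phi n X lambda p = ('E_P[f \o Y])%E.
  rewrite /phi /mmt_gen_fun; congr expectation; apply/funext => w /=.
  have -> : empirical R n (fun i => X i w) = empirical R n (Y w).
    by apply/funext => i; rewrite /empirical ffunE.
  by rewrite /f [lambda * _]mulrC.
rewrite (@expectation_countable _ _ _ P _ Y mY s) // => [|y]; last exact: expR_ge0.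
rewrite big_map /G [X in (_ <= X%:E)%E]big_mkcond /= -sumEFin.
apply: lee_sum => x _; rewrite YE hX -EFinM lee_fin.
have vx : (v x : 'I_k -> nat) = (fun i => x i : nat).
  by apply/funext => i; rewrite ffunE.
rewrite /f vx.
exact: multinomial_pmf_tilt_le hn hlambda hp.1.
Qed.
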